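(* Let $n>1$ be a positive integer with $\gcd(n,6)=1$ and let $k$ be a positive integer. Then $$\prod_{d\mid n}\binom{kd-1}{(d-1)/2}^{\mu(n/d)}\equiv(-1)^{\frac{\phi(n)}{2}}\left\{4^{k\phi(n)}-\frac{k(7-14k+8k^2)}{4}\,n^3\,\frac{B_{\phi(n)-2,\chi_n}}{\phi(n)-2}\right\}\pmod{n^4}.$$
   Context: $\mu$ is the Möbius function and $\phi$ is Euler's totient function. $B_s$ denotes the $s$-th Bernoulli number, and for the trivial Dirichlet character $\chi_n$ modulo $n$ (i.e. $\chi_n(x)=1$ if $\gcd(x,n)=1$ and $0$ otherwise) the generalized Bernoulli numbers are $B_{s,\chi_n}=B_s\prod_{p\mid n}(1-p^{s-1})$ (product over primes $p$ dividing $n$). For rational numbers $a,b$ and a positive integer $N$, $a\equiv b\pmod N$ means that $(a-b)/N$ is a rational number whose denominator is coprime to $N$. *)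

(* Defs.v *)
From mathcomp Require Export all_boot all_order all_algebra.

Set Implicit Arguments.
Unset Strict Implicit.
Unset Printing Implicit Defensive.

Import Order.TTheory GRing.Theory Num.Theory.
Local Open Scope ring_scope.

(* Only meaningful for 0 < n. *)
Definition moebius (n : nat) : int :=
  if all (fun p => logn p n == 1%N) (primes n)
  then (-1) ^+ size (primes n) else 0.

(* [:: B_0; ...; B_(n-1)], from the recurrence
   \sum_(j <= m) 'C(m + 1, j) B_j = (m == 0), so that B_1 = - 1 / 2. *)
Fixpoint bernoulli_seq (n : nat) : seq rat :=
  if n is m.+1 then
    let s := bernoulli_seq m in
    rcons s (((m == 0%N)%:R - \sum_(j < m) 'C(m.+1, j)%:R * s`_j) / m.+1%:R)
  else [::].

Definition bernoulli (n : nat) : rat := (bernoulli_seq n.+1)`_n.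

(* The generalized Bernoulli number B_(s, chi_n) of the trivial character
   modulo n; the exponent s - 1 is an integer. *)
Definition bernoulli_triv (s n : nat) : rat :=
  bernoulli s * \prod_(p <- primes n) (1 - p%:R ^ (s%:Z - 1)).

Definition eqmodq (a b : rat) (N : nat) : Prop :=
  coprimez (denq ((a - b) / N%:R)) N%:Z.

Lemma size_bernoulli_seq n : size (bernoulli_seq n) = n.
Proof. by elim: n => //= n IHn; rewrite size_rcons IHn. Qed.

Lemma nth_bernoulli_seq n j :
  (j < n)%N -> (bernoulli_seq n)`_j = bernoulli j.
Proof.
elim: n => // n IHn; rewrite ltnS leq_eqVlt => /orP[/eqP-> // | lt_jn].
by rewrite /= nth_rcons size_bernoulli_seq lt_jn IHn.
Qed.

Lemma bernoulli_rec n :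
  \sum_(j < n.+1) 'C(n.+1, j)%:R * bernoulli j = (n == 0%N)%:R.
Proof.
rewrite big_ord_recr /= binSn {2}/bernoulli /=.
rewrite nth_rcons size_bernoulli_seq ltnn eqxx.
rewrite mulrC divfK ?pnatr_eq0 //.
rewrite (eq_bigr (fun j : 'I_n => 'C(n.+1, j)%:R * (bernoulli_seq n)`_j)).
  by rewrite addrC subrK.
by move=> j _; rewrite nth_bernoulli_seq.
Qed.

(* Main.v *)
(* Since a divisor [d] of [n] contributes the factors [(k d - j) / j = (k n - J) / J]
   with [J = j n / d], Moebius inversion turns the left-hand side into the product
   of [(k n - j) / j] over the units [j < n / 2], i.e. into
   [(-1)^(phi(n)/2) P(k)] with [P(t) = \prod_j (1 - t n / j)].

   Let [S_i] be the sum of the [j^(-i)].  Comparing the splittings of the units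
   below [n] into [j, n - j] and into [2 j, n - 2 j] gives
   [P(1) = 2^phi(n) P(1/2)] (product of all units) and
   [6 n^2 S_2 = - 7 n^3 S_3 mod n^4] (sum of their inverse squares).  As [n^4 = 0],
   [P(t) = exp (- t n S_1 - t^2 n^2 S_2 / 2 - t^3 n^3 S_3 / 3)], so these two
   relations eliminate [S_1] and [S_2]:
   [P(k) = 4^(k phi(n)) - k (7 - 14 k + 8 k^2) / 24 n^3 S_3 mod n^4].

   Finally [S_3 = 6 B_(phi(n)-2, chi_n) / (phi(n) - 2) mod n].  With
   [m = phi(n) - 3], the alternating sum of [j^m] over the units below [n] is
   [2^(m+1) S_3] modulo [n]; by inclusion-exclusion and the Euler polynomial
   [E_m] it is also [E_m(0) \prod_(p | n) (1 - p^m)], where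
   [E_m(0) = 2 (1 - 2^(m+1)) B_(m+1) / (m+1)].  The Euler polynomials have
   denominators powers of 2, which spares the von Staudt and Kummer theorems. *)

Require Import Defs.
From mathcomp Require Import all_boot all_order all_algebra cyclic.
From mathcomp Require Import zify ring lra.

Set Implicit Arguments.
Unset Strict Implicit.
Unset Printing Implicit Defensive.

Import Order.TTheory GRing.Theory Num.Theory.
Local Open Scope ring_scope.

(** * Bernoulli numbers and Euler polynomials *)

(** The linear functional sending ['X^i] to [a i]; recurrences for [a] become identities about
    [p(X + 1)], to be checked on monomials only. *)
Definition umbral (a : nat -> rat) (p : {poly rat}) : rat :=
  \sum_(i < size p) p`_i * a i.

Lemma umbral_widen a (p : {poly rat}) m : (size p <= m)%N ->
  umbral a p = \sum_(i < m) p`_i * a i.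
Proof.
move=> lepm; rewrite /umbral (big_ord_widen _ (fun i => p`_i * a i) lepm).
rewrite big_mkcond; apply: eq_bigr => i _.
by case: ltnP => // le; rewrite nth_default ?mul0r.
Qed.

Lemma umbralP a c p q : umbral a (c *: p + q) = c * umbral a p + umbral a q.
Proof.
set m := maxn (size p) (size q).
have lep : (size p <= m)%N by rewrite leq_maxl.
have leq : (size q <= m)%N by rewrite leq_maxr.
have lepq : (size (c *: p + q)%R <= m)%N.
  rewrite (leq_trans (size_polyD _ _)) // geq_max leq andbT.
  exact: leq_trans (size_scale_leq _ _) lep.
rewrite (umbral_widen a lep) (umbral_widen a leq) (umbral_widen a lepq).
rewrite mulr_sumr -big_split /=.
by apply: eq_bigr => i _; rewrite coefD coefZ mulrDl mulrA.
Qed.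

Lemma umbral0 a : umbral a 0 = 0.
Proof. by rewrite /umbral size_poly0 big_ord0. Qed.

Lemma umbralZ a c p : umbral a (c *: p) = c * umbral a p.
Proof. by rewrite -[c *: p]addr0 umbralP umbral0 addr0. Qed.

Lemma umbral_sum a (I : Type) (r : seq I) (F : I -> {poly rat}) :
  umbral a (\sum_(i <- r) F i) = \sum_(i <- r) umbral a (F i).
Proof.
apply: (big_morph (umbral a) _ (umbral0 a)) => p q.
by rewrite -[p]scale1r umbralP mul1r scale1r.
Qed.

Lemma umbralMn a p m : umbral a (p *+ m) = m%:R * umbral a p.
Proof. by rewrite -scaler_nat umbralZ. Qed.

Lemma umbralXn a m : umbral a 'X^m = a m.
Proof.
rewrite /umbral size_polyXn big_ord_recr /= coefXn eqxx mul1r big1 ?add0r //.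
by move=> i _; rewrite coefXn ltn_eqF ?mul0r.
Qed.

Lemma umbral_XDn a (x : rat) m :
  umbral a (('X + x%:P) ^+ m) = \sum_(i < m.+1) 'C(m, i)%:R * a i * x ^+ (m - i).
Proof.
rewrite addrC exprDn umbral_sum; apply: eq_bigr => i _.
rewrite -polyC_exp mul_polyC umbralMn umbralZ umbralXn; ring.
Qed.

Lemma umbral_ZXn a (x : rat) m : umbral a ((x *: 'X) ^+ m) = x ^+ m * a m.
Proof. by rewrite exprZn umbralZ umbralXn. Qed.

Lemma scalar_poly_eq0 (f : {poly rat} -> rat) :
  (forall c p q, f (c *: p + q) = c * f p + f q) ->
  (forall m, f 'X^m = 0) -> forall p, f p = 0.
Proof.
move=> fP fX p; rewrite -[p]coefK poly_def.
have f0 : f 0 = 0 by have := fP 1 0 0; rewrite scale1r addr0; lra.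
elim/big_rec: _ => // i q _ fq0.
by rewrite fP fX fq0 mulr0 addr0.
Qed.

(** By linearity it suffices to take ['X^m], where this is the defining recurrence of the Bernoulli
    numbers. *)
Lemma bernoulli_shift (p : {poly rat}) :
  umbral bernoulli (p \Po ('X + 1)) = umbral bernoulli p + p`_1.
Proof.
pose f p := umbral bernoulli (p \Po ('X + 1)) - (umbral bernoulli p + p`_1).
suff: f p = 0 by rewrite /f => /eqP; rewrite subr_eq0 => /eqP.
apply: scalar_poly_eq0 => [c q r|m]; rewrite /f.
  by rewrite comp_polyD comp_polyZ !umbralP coefD coefZ; ring.
apply/eqP; rewrite subr_eq0 comp_Xn_poly -polyC1 umbral_XDn umbralXn coefXn.
under eq_bigr do rewrite expr1n mulr1.
rewrite big_ord_recr /= binn mul1r addrC; apply/eqP; congr (_ + _).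
by case: m => [|m]; rewrite ?big_ord0 // bernoulli_rec; case: m.
Qed.

(* Both sides, as functionals of [p], are determined by their values on the
   differences [p(X + 1) - p(X)], which span all polynomials. *)
Lemma bernoulli_double (p : {poly rat}) :
  umbral bernoulli (p \Po (2 *: 'X + 1)) + umbral bernoulli (p \Po (2 *: 'X))
  = 2 * umbral bernoulli p.
Proof.
pose D p := umbral bernoulli (p \Po (2 *: 'X + 1)) +
  umbral bernoulli (p \Po (2 *: 'X)) - 2 * umbral bernoulli p.
have DP c q r : D (c *: q + r) = c * D q + D r.
  by rewrite /D !comp_polyD !comp_polyZ !umbralP; ring.
have coef1 q : (q \Po (2 *: 'X))`_1 = 2 * q`_1 :> rat.
  suff: (q \Po (2 *: 'X))`_1 - 2 * q`_1 = 0 :> rat by lra.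
  apply: (scalar_poly_eq0 (f := fun q => (q \Po (2 *: 'X))`_1 - 2 * q`_1)).
    by move=> c r t; rewrite comp_polyD comp_polyZ !coefD !coefZ; ring.
  move=> m; rewrite comp_Xn_poly exprZn coefZ coefXn.
  by case: m => [|[|m]] /=; ring.
(* The shift turns [q(2X + 1)] and [q(2X)] into [q(2X + 2)] and [q(2X + 1)]; both parts of [D] grow
   by twice the coefficient of [X] in [q]. *)
have DE q : D (q \Po ('X + 1)) = D q.
  rewrite /D bernoulli_shift -!comp_polyA !comp_polyD !comp_polyX.
  rewrite -polyC1 !comp_polyC polyC1.
  have -> : 2 *: 'X + 1 + 1 = (2 *: 'X) \Po ('X + 1) :> {poly rat}.
    rewrite comp_polyZ comp_polyX scalerDr -addrA; congr (_ + _).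
    by rewrite scaler_nat mulr2n.
  rewrite comp_polyA bernoulli_shift coef1; ring.
have D0 m : D 'X^m = 0.
  elim/ltn_ind: m => m IH.
  (* [D] agrees on [(X + 1)^(m+1)] and [X^(m+1)]; by induction only [(m + 1) D(X^m)] survives in the
     difference. *)
  have := DE 'X^(m.+1); rewrite comp_Xn_poly addrC exprDn.
  rewrite big_ord_recr big_ord_recr /= !expr1n !mul1r binn mulr1n binSn.
  rewrite -addrA -scaler_nat.
  have -> : \sum_(i < m) 1 ^+ (m.+1 - i) * 'X^i *+ 'C(m.+1, i) =
     \sum_(i < m) 'C(m.+1, i)%:R *: 'X^i :> {poly rat}.
    by apply: eq_bigr => i _; rewrite expr1n mul1r scaler_nat.
  have -> q : D (\sum_(i < m) 'C(m.+1, i)%:R *: 'X^i + q) = D q.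
    elim/big_rec: _ => [|i r _ <-]; first by rewrite add0r.
    by rewrite -addrA DP IH ?mulr0 ?add0r.
  rewrite DP => /eqP; rewrite -subr_eq0 addrK mulf_eq0 pnatr_eq0 /=.
  by move/eqP.
have: D p = 0 by apply: scalar_poly_eq0.
rewrite /D; lra.
Qed.

(* The value at [0] of the [m]-th Euler polynomial. *)
Definition euler0 (m : nat) : rat :=
  2 * (1 - 2 ^+ m.+1) * bernoulli m.+1 / m.+1%:R.

(** This is [E_m(1) + E_m(0) = 2 * 0^m]. As [(m+1) C(m,i) = (i+1) C(m+1,i+1)], the sum times [m + 1]
    is twice the difference of the Bernoulli functional at [(X + 1)^(m+1)] and [(2X + 1)^(m+1)],
    known from shift and duplication. *)
Lemma euler0_rec m :
  \sum_(i < m.+1) 'C(m, i)%:R * euler0 i = 2 * (m == 0%N)%:R - euler0 m.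
Proof.
have m1 : m.+1%:R != 0 :> rat by rewrite pnatr_eq0.
have sumE : m.+1%:R * \sum_(i < m.+1) 'C(m, i)%:R * euler0 i =
   2 * (umbral bernoulli (('X + 1) ^+ m.+1)
        - umbral bernoulli ((2 *: 'X + 1) ^+ m.+1)).
  have -> : umbral bernoulli ((2 *: 'X + 1) ^+ m.+1) =
    umbral (fun i => 2 ^+ i * bernoulli i) (('X + 1) ^+ m.+1).
    rewrite addrC exprDn [RHS]/= [in RHS]addrC exprDn !umbral_sum.
    apply: eq_bigr => i _.
    by rewrite expr1n !mul1r !umbralMn umbral_ZXn umbralXn.
  (* The term of index 0 drops out because [1 - 2^0 = 0]. *)
  rewrite -polyC1 !umbral_XDn -sumrB [X in 2 * X]big_ord_recl /=.
  rewrite expr0 [X in _ - _ * X * _]mul1r subrr add0r !mulr_sumr; apply: eq_bigr => i _.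
  rewrite !expr1n !mulr1 /bump /= add1n /euler0.
  have i1 : i.+1%:R != 0 :> rat by rewrite pnatr_eq0.
  have bE : m.+1%:R * 'C(m, i)%:R = i.+1%:R * 'C(m.+1, i.+1)%:R :> rat.
    by rewrite -!natrM mul_bin_diag.
  rewrite mulrA bE; field.
  by rewrite nat1r.
have := bernoulli_shift 'X^(m.+1); have := bernoulli_double 'X^(m.+1).
rewrite !comp_Xn_poly umbralXn umbral_ZXn coefXn => dbl shift.
apply: (mulfI m1); rewrite sumE shift [RHS]mulrBr.
have -> : m.+1%:R * euler0 m = 2 * (1 - 2 ^+ m.+1) * bernoulli m.+1.
  by rewrite /euler0 mulrC divfK.
move/(canRL (addrK _)): dbl => ->; rewrite eqSS eq_sym.
have -> : m.+1%:R * (2 * (m == 0%N)%:R) = 2 * (m == 0%N)%:R :> rat.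
  by case: (m) => [|m'] /=; rewrite ?mul1r ?mulr0.
by ring.
Qed.

Lemma Qint_sum (I : eqType) (r : seq I) (F : I -> rat) :
  (forall i, i \in r -> F i \is a Num.int) -> \sum_(i <- r) F i \is a Num.int.
Proof. by move=> FI; rewrite big_seq; apply: rpred_sum. Qed.

(** For [m > 0] the recurrence expresses [2 * euler0 m] through earlier values with integer
    coefficients, so each index costs one factor 2. *)
Lemma euler0_int m : 2 ^+ m * euler0 m \is a Num.int.
Proof.
elim/ltn_ind: m => m IH.
have := euler0_rec m; rewrite big_ord_recr /= binn mul1r.
case: m IH => [_|m IH sE].
  by rewrite big_ord0 /=; move: (euler0 0) => e E; have -> : e = 1 by lra.
have -> : 2 ^+ m.+1 * euler0 m.+1 = - \sum_(i < m.+1) 'C(m.+1, i)%:R *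
    2 ^+ (m - i) * (2 ^+ i * euler0 i).
  have -> : \sum_(i < m.+1) 'C(m.+1, i)%:R * 2 ^+ (m - i) * (2 ^+ i * euler0 i)
    = 2 ^+ m * \sum_(i < m.+1) 'C(m.+1, i)%:R * euler0 i.
    rewrite mulr_sumr; apply: eq_bigr => i _.
    have im : (i <= m)%N by rewrite -ltnS.
    have -> : 2 ^+ m = 2 ^+ (m - i) * 2 ^+ i :> rat by rewrite -exprD subnK.
    ring.
  have -> : \sum_(i < m.+1) 'C(m.+1, i)%:R * euler0 i = - (2 * euler0 m.+1).
    by rewrite /= in sE; lra.
  by rewrite exprS; ring.
rewrite rpredN; apply: Qint_sum => i _.
apply: rpredM (IH _ (ltn_ord i)).
by rewrite rpredM ?rpredX ?rpred_nat.
Qed.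

Definition euler_poly (m : nat) (x : rat) : rat :=
  \sum_(i < m.+1) 'C(m, i)%:R * euler0 i * x ^+ (m - i).

(** Extended linearly, [euler0_rec] says that the functional of [euler0] sends [p(X + 1) + p(X)] to
    [2 * p(0)]; take [p = (X + x)^m]. *)
Lemma euler_polyD1 m x : euler_poly m (x + 1) + euler_poly m x = 2 * x ^+ m.
Proof.
have shift (p : {poly rat}) :
  umbral euler0 (p \Po ('X + 1)) + umbral euler0 p = 2 * p.[0].
  rewrite horner_coef0.
  pose f p := umbral euler0 (p \Po ('X + 1)) + umbral euler0 p - 2 * p`_0.
  suff: f p = 0 by rewrite /f; lra.
  apply: scalar_poly_eq0 => [c q r|m']; rewrite /f.
    by rewrite comp_polyD comp_polyZ !umbralP coefD coefZ; ring.
  rewrite comp_Xn_poly -polyC1 umbral_XDn umbralXn coefXn.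
  under eq_bigr do rewrite expr1n mulr1.
  by rewrite euler0_rec subrK eq_sym subrr.
have := shift (('X + x%:P) ^+ m).
rewrite rmorphXn /= comp_polyD comp_polyX comp_polyC -addrA -polyC1 -polyCD.
by rewrite !umbral_XDn horner_exp hornerD hornerX hornerC add0r addrC [1 + x]addrC addrC.
Qed.

Lemma euler_poly_alternating m n :
  2 * \sum_(j < n) (-1) ^+ j * j%:R ^+ m
  = euler_poly m 0 - (-1) ^+ n * euler_poly m n%:R.
Proof.
elim: n => [|n IH]; first by rewrite big_ord0 mulr0 mul1r subrr.
rewrite big_ord_recr /= mulrDr IH exprS -[n.+1%:R]natr1.
have := euler_polyD1 m n%:R; move/(canRL (addrK _)) => ->; ring.
Qed.

Lemma euler_poly0 m : euler_poly m 0 = euler0 m.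
Proof.
rewrite /euler_poly big_ord_recr /= binn subnn mul1r mulr1 big1 ?add0r //.
by move=> i _; rewrite expr0n subn_eq0 leqNgt ltn_ord mulr0.
Qed.

(** Every term of [E_m(q) - E_m(0)] carries a positive power of [q], [d ^ m] supplies the factor
    [d], and [2 ^ m] clears the denominators. *)
Lemma euler_poly_int m d q : (0 < m)%N -> (0 < d * q)%N ->
  2 ^+ m * d%:R ^+ m * (euler_poly m q%:R - euler0 m) / (d * q)%:R \is a Num.int.
Proof.
move=> m0; rewrite muln_gt0 => /andP[d0 q0].
rewrite /euler_poly big_ord_recr /= binn subnn mul1r mulr1 addrK.
rewrite mulr_sumr mulr_suml; apply: Qint_sum => i _.
have -> : 2 ^+ m * d%:R ^+ m * ('C(m, i)%:R * euler0 i * q%:R ^+ (m - i)) / (d * q)%:R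
  = 'C(m, i)%:R * 2 ^+ (m - i) * d%:R ^+ m.-1 * q%:R ^+ (m - i).-1
    * (2 ^+ i * euler0 i) :> rat.
  have d0' : d%:R != 0 :> rat by rewrite pnatr_eq0 -lt0n.
  have q0' : q%:R != 0 :> rat by rewrite pnatr_eq0 -lt0n.
  have mi : (0 < m - i)%N by rewrite subn_gt0.
  have im : (i <= m)%N := ltnW (ltn_ord i).
  have -> : 2 ^+ m = 2 ^+ (m - i) * 2 ^+ i :> rat by rewrite -exprD subnK.
  have -> : d%:R ^+ m = d%:R * d%:R ^+ m.-1 :> rat by rewrite -exprS prednK.
  have -> : q%:R ^+ (m - i) = q%:R * q%:R ^+ (m - i).-1 :> rat.
    by rewrite -exprS prednK.
  by rewrite natrM; field; apply/andP.
by apply: rpredM (euler0_int i); rewrite !rpredM ?rpredX ?rpred_nat.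
Qed.

(** * The Moebius function *)

Lemma primes_mul_coprime p d : prime p -> (0 < d)%N -> coprime p d ->
  perm_eq (primes (p * d)) (p :: primes d).
Proof.
move=> pp d0 cpd; apply: uniq_perm; rewrite ?primes_uniq //=.
  by rewrite primes_uniq andbT mem_primes pp d0 /= -prime_coprime.
by move=> q; rewrite primesM ?(prime_gt0 pp) // primes_prime // !inE.
Qed.

Lemma moebius_mul_coprime p d : prime p -> (0 < d)%N -> coprime p d ->
  moebius (p * d) = - moebius d.
Proof.
move=> pp d0 cpd; rewrite /moebius.
have pE := primes_mul_coprime pp d0 cpd.
rewrite (perm_all _ pE) (perm_size pE) /= lognM ?(prime_gt0 pp) // logn_prime //.
rewrite eqxx (logn_coprime cpd) /= exprS mulN1r.
have -> : all (fun q => logn q (p * d) == 1%N) (primes d)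
        = all (fun q => logn q d == 1%N) (primes d).
  apply: eq_in_all => q; rewrite mem_primes => /and3P[pq _ qd].
  rewrite lognM ?(prime_gt0 pp) // logn_prime //.
  have -> // : (q == p) = false.
  by apply/eqP=> qp; rewrite prime_coprime // -qp qd in cpd.
by case: ifP; rewrite ?oppr0.
Qed.

Lemma moebius_mul_dvd p d : prime p -> (0 < d)%N -> (p %| d)%N ->
  moebius (p * d) = 0.
Proof.
move=> pp d0 pd; rewrite /moebius; case: ifP => // /allP/(_ p).
rewrite mem_primes pp muln_gt0 d0 prime_gt0 // dvdn_mulr // => /(_ isT).
rewrite lognM ?(prime_gt0 pp) // logn_prime // eqxx => /eqP[] /eqP.
by rewrite -leqn0 leqNgt logn_gt0 mem_primes pp d0 pd.
Qed.

Lemma divisors_mul_pfactor p m e : prime p -> (0 < m)%N -> coprime p m ->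
  perm_eq [seq d <- divisors (m * p ^ e) | ~~ (p %| d)%N] (divisors m).
Proof.
move=> pp m0 cpm; have n0 : (0 < m * p ^ e)%N by rewrite muln_gt0 m0 expn_gt0 prime_gt0.
apply: uniq_perm; rewrite ?filter_uniq ?divisors_uniq // => d.
rewrite mem_filter -!dvdn_divisors //.
apply/andP/idP => [[npd] | dm].
  by rewrite Gauss_dvdl // coprime_sym coprimeXl // prime_coprime.
split; last by rewrite dvdn_mulr.
apply/negP => pd; move: cpm; rewrite prime_coprime //.
by rewrite (dvdn_trans pd dm).
Qed.

Lemma big_divisors_mul (R : nmodType) p m (F : nat -> R) : prime p -> (0 < m)%N ->
  \sum_(d <- divisors (p * m) | (p %| d)%N) F d = \sum_(d <- divisors m) F (p * d)%N.
Proof.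
move=> pp m0; have p0 := prime_gt0 pp.
have pm0 : (0 < p * m)%N by rewrite muln_gt0 p0.
rewrite -big_filter -[RHS](big_map (muln p) xpredT).
apply: perm_big; apply: uniq_perm.
- by rewrite filter_uniq ?divisors_uniq.
- rewrite map_inj_uniq ?divisors_uniq // => x y /eqP.
  by rewrite eqn_pmul2l // => /eqP.
move=> d; rewrite mem_filter -dvdn_divisors //.
apply/andP/mapP => [[/dvdnP[x ->]] | [x]].
  by rewrite mulnC dvdn_pmul2l // => xm; exists x; rewrite // -dvdn_divisors.
by rewrite -dvdn_divisors // => xm ->; rewrite dvdn_mulr // dvdn_pmul2l.
Qed.

(** Induction, with [m] the part of [n] prime to a prime factor [p]: the divisors prime to [p] are
    those of [m], the [p * d] with [d] dividing [m] give [- h p] times the same sum, and multiples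
    of [p ^ 2] contribute nothing. *)
Lemma sum_moebius (R : comPzRingType) (h : nat -> R) n :
  h 1%N = 1 -> {morph h : a b / (a * b)%N >-> a * b} -> (0 < n)%N ->
  \sum_(d <- divisors n) (moebius d)%:~R * h d = \prod_(p <- primes n) (1 - h p).
Proof.
move=> h1 hM; elim/ltn_ind: n => n IH n0.
have [n1|n1] := leqP n 1.
  have -> : n = 1%N by lia.
  by rewrite big_seq1 big_nil h1 mulr1.
have [p pp pn] := pdivP n1; have p0 := prime_gt0 pp.
have [m cpm nE] := pfactor_coprime pp n0.
have e0 : (0 < logn p n)%N by rewrite logn_gt0 mem_primes pp n0 pn.
case: (logn p n) e0 nE => // e _ nE.
have m0 : (0 < m)%N by move: n0; rewrite nE; case: m {cpm nE}.
have mp0 : (0 < m * p ^ e)%N by rewrite muln_gt0 m0 expn_gt0 p0.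
have mn : (m < n)%N.
  by rewrite nE -[ltnLHS]muln1 ltn_pmul2l // -(expn0 p) ltn_exp2l // prime_gt1.
have prE : perm_eq (primes n) (p :: primes m).
  apply: perm_trans (primes_mul_coprime pp m0 cpm).
  apply: uniq_perm; rewrite ?primes_uniq // => q.
  by rewrite nE mulnC primesM ?expn_gt0 ?p0 // primesX // primesM.
have sumF (G : nat -> R) e' :
    \sum_(d <- divisors (m * p ^ e') | ~~ (p %| d)%N) G d = \sum_(d <- divisors m) G d.
  by rewrite -big_filter; apply/perm_big/divisors_mul_pfactor.
rewrite (perm_big _ prE) big_cons /= -(IH m) //.
rewrite (bigID (fun d => (p %| d)%N)) /= {2}nE sumF nE expnS mulnCA.
rewrite big_divisors_mul // (bigID (fun d => (p %| d)%N)) /= sumF.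
rewrite big_seq_cond big1 ?add0r; last first.
  move=> d /andP[]; rewrite -dvdn_divisors // => dm pd.
  by rewrite moebius_mul_dvd ?mul0r // (dvdn_gt0 _ dm).
rewrite mulrBl mul1r addrC; congr (_ + _).
rewrite mulr_sumr -sumrN; apply: eq_big_seq => d; rewrite -dvdn_divisors // => dm.
rewrite moebius_mul_coprime ?(dvdn_gt0 _ dm) ?(coprime_dvdr dm) // hM rmorphN /=.
by rewrite mulNr mulrCA.
Qed.

Lemma sum_moebius_dvd n j : (0 < n)%N ->
  \sum_(d <- divisors n | (d %| j)%N) moebius d = (coprime n j)%:R.
Proof.
move=> n0; have g0 : (0 < gcdn n j)%N by rewrite gcdn_gt0 n0.
have dE : perm_eq [seq d <- divisors n | (d %| j)%N] (divisors (gcdn n j)).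
  apply: uniq_perm; rewrite ?filter_uniq ?divisors_uniq // => d.
  by rewrite mem_filter -!dvdn_divisors // dvdn_gcd andbC.
rewrite -big_filter (perm_big _ dE) /=.
have := @sum_moebius int (fun=> 1) (gcdn n j) erefl (fun _ _ => esym (mulr1 1)) g0.
have -> : \sum_(d <- divisors (gcdn n j)) moebius d
    = \sum_(d <- divisors (gcdn n j)) (moebius d)%:~R * 1.
  by apply: eq_bigr => d _; rewrite intz mulr1.
move=> ->; rewrite /coprime; have [->|g1] := eqVneq; first by rewrite big_nil.
have [|p pp pg] := @pdivP (gcdn n j); first by lia.
rewrite (big_rem p) /= ?subrr ?mul0r //.
by rewrite mem_primes pp g0.
Qed.

(** * Multiples of divisors, and the binomial product over the units *)

Lemma big_nat_dvd (R : Type) (idx : R) (op : Monoid.law idx) c m (F : nat -> R) :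
  (0 < c)%N ->
  \big[op/idx]_(1 <= j < m.+1 | (c %| j)%N) F j
  = \big[op/idx]_(1 <= j < (m %/ c).+1) F (c * j)%N.
Proof.
move=> c0; elim: m => [|m IH]; first by rewrite div0n !big_geq.
rewrite big_mkcond big_nat_recr //= -big_mkcond IH divnS //.
case: ifP => cm; last by rewrite add0n Monoid.mulm1.
rewrite add1n [RHS]big_nat_recr //=; congr (op _ (F _)).
have : (m.+1 %/ c = (m %/ c).+1)%N by rewrite divnS // cm add1n.
by move=> <-; rewrite mulnC divnK.
Qed.

Lemma expfz_sum (F : fieldType) (I : Type) (r : seq I) (P : pred I)
    (e : I -> int) (x : F) : x != 0 ->
  x ^ (\sum_(i <- r | P i) e i) = \prod_(i <- r | P i) x ^ e i.
Proof. by move=> x0; apply: (big_morph (exprz x)) => // a b; rewrite expfzDr. Qed.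

Lemma expfz_prod (F : fieldType) (I : Type) (r : seq I) (P : pred I)
    (f : I -> F) (z : int) :
  (\prod_(i <- r | P i) f i) ^ z = \prod_(i <- r | P i) f i ^ z.
Proof.
by apply: (big_morph (fun x : F => x ^ z)) => [a b|]; rewrite ?expfzMl ?exp1rz.
Qed.

Lemma big_divisors_rev (R : Type) (idx : R) (op : Monoid.com_law idx) n (F : nat -> R) :
  (0 < n)%N ->
  \big[op/idx]_(d <- divisors n) F d = \big[op/idx]_(d <- divisors n) F (n %/ d)%N.
Proof.
move=> n0; rewrite -[RHS](big_map (divn n) xpredT); apply: perm_big.
have inv d : (d %| n)%N -> (n %/ (n %/ d))%N = d by move=> dn; rewrite divnA // mulKn.
apply: uniq_perm; rewrite ?divisors_uniq //.
  rewrite map_inj_in_uniq ?divisors_uniq // => x y.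
  rewrite -!dvdn_divisors // => xn yn E.
  by rewrite -(inv x xn) E inv.
move=> d; rewrite -dvdn_divisors //; apply/idP/mapP => [dn|[x]].
  by exists (n %/ d)%N; rewrite ?inv // -dvdn_divisors // dvdn_div.
by rewrite -dvdn_divisors // => xn ->; rewrite dvdn_div.
Qed.

Lemma bin_half_prod k d : odd d -> (0 < k)%N ->
  'C(k * d - 1, (d - 1) %/ 2)%:R
  = \prod_(1 <= j < (d./2).+1) ((k%:R * d%:R - j%:R) / j%:R) :> rat.
Proof.
move=> od k0; have -> : ((d - 1) %/ 2 = d./2)%N by lia.
set h := d./2; have hkd : (h < k * d)%N by rewrite /h; nia.
rewrite big_split /= prodfV -natr_prod -fact_prod.
apply: (canRL (mulfK _)); first by rewrite pnatr_eq0 -lt0n fact_gt0.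
rewrite -[LHS]natrM bin_ffact ffact_prod natr_prod big_add1 /= big_mkord.
apply: eq_bigr => i _; rewrite -natrM -natrB; first by congr (_%:R); lia.
by have := ltn_ord i; lia.
Qed.

(** With [c = n / d], the factors from [d] are the [F j] for the multiples [j <= n / 2] of [c].
    Hence [F j] gets as exponent the sum of [moebius c] over the common divisors [c] of [n] and
    [j]. *)
Lemma prod_bin_moebius n k : odd n -> (0 < k)%N ->
  \prod_(d <- divisors n)
     ('C(k * d - 1, (d - 1) %/ 2)%:R : rat) ^ moebius (n %/ d)
  = \prod_(1 <= j < (n./2).+1 | coprime n j) ((k%:R * n%:R - j%:R) / j%:R).
Proof.
move=> on k0; have n0 : (0 < n)%N by case: n on.
rewrite big_divisors_rev //=.
pose F j : rat := (k%:R * n%:R - j%:R) / j%:R.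
transitivity (\prod_(c <- divisors n)
    \prod_(1 <= j < (n./2).+1 | (c %| j)%N) F j ^ moebius c).
  apply: eq_big_seq => c; rewrite -dvdn_divisors // => cn.
  have c0 : (0 < c)%N := dvdn_gt0 n0 cn.
  have nE : n = (c * (n %/ c))%N by rewrite mulnC divnK.
  have odc : odd (n %/ c) by move: on; rewrite {1}nE oddM => /andP[].
  have -> : (n %/ (n %/ c))%N = c by rewrite divnA // mulKn.
  rewrite bin_half_prod // expfz_prod big_nat_dvd //.
  have -> : ((n %/ c)./2 = n./2 %/ c)%N by rewrite -!divn2 divnAC.
  apply: eq_big_nat => j /andP[j0 _]; congr (_ ^ _).
  have c0' : c%:R != 0 :> rat by rewrite pnatr_eq0 -lt0n.
  have j0' : j%:R != 0 :> rat by rewrite pnatr_eq0 -lt0n.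
  rewrite /F {2}nE !natrM; field; exact/andP.
under eq_bigr do rewrite big_mkcond.
rewrite exchange_big /= [RHS]big_mkcond.
apply: eq_big_nat => j /andP[j0 jn].
(* True since [j <= n / 2 < k n]; adding exponents of both signs requires a nonzero base. *)
have Fj : F j != 0.
  rewrite /F mulf_neq0 ?invr_eq0 ?pnatr_eq0 -?lt0n //.
  rewrite -natrM -natrB ?pnatr_eq0; nia.
rewrite -big_mkcond -expfz_sum // sum_moebius_dvd //.
by case: coprime.
Qed.

Lemma sum_coprime_moebius (R : pzRingType) n (F : nat -> R) : (0 < n)%N ->
  \sum_(1 <= j < n | coprime n j) F j
  = \sum_(d <- divisors n) (moebius d)%:~R * \sum_(1 <= i < n %/ d) F (d * i)%N.
Proof.
move=> n0.
transitivity (\sum_(d <- divisors n)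
    \sum_(1 <= j < n | (d %| j)%N) (moebius d)%:~R * F j).
  under [RHS]eq_bigr do rewrite big_mkcond.
  rewrite exchange_big /= big_mkcond; apply: eq_bigr => j _.
  rewrite -big_mkcond -mulr_suml -rmorph_sum sum_moebius_dvd //.
  by case: coprime; rewrite ?mul1r ?mul0r.
apply: eq_big_seq => d; rewrite -dvdn_divisors // => dn.
have d0 : (0 < d)%N := dvdn_gt0 n0 dn.
rewrite -mulr_sumr; congr (_ * _).
(* Multiples of [d] below [n = m + 1] have quotient at most [m / d = n / d - 1]. *)
case: n n0 dn => // m _ dm; rewrite big_nat_dvd //; congr bigop.
by rewrite divnS // dm.
Qed.

(** * Truncated exponentials *)

Section TruncatedExp.
Variables (R : comPzRingType) (N h t : R).
Hypotheses (N4 : N ^+ 4 = 0) (h2 : 2 * h = 1) (t3 : 3 * t = 1).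

(** This is [exp(N * y)], cut off because [N ^+ 4 = 0]; [h] and [t] stand for 1/2 and 1/3. *)
Definition texp (y : R) : R := 1 + N * y + N ^+ 2 * y ^+ 2 * h + N ^+ 3 * y ^+ 3 * (h * t).

Lemma texpD y z : texp (y + z) = texp y * texp z.
Proof.
have h0 : 2 * h - 1 = 0 by rewrite h2 subrr.
have t0 : 3 * t - 1 = 0 by rewrite t3 subrr.
apply/eqP; rewrite -subr_eq0; apply/eqP; rewrite /texp.
(* The difference is written as an explicit element of the ideal generated by [N ^+ 4], [2 * h - 1]
   and [3 * t - 1]. *)
transitivity (N ^+ 4 * - (y ^+ 2 * z ^+ 2 * h ^+ 2
    + (y * z ^+ 3 + y ^+ 3 * z) * (h * t)
    + N * (y ^+ 2 * z ^+ 3 + y ^+ 3 * z ^+ 2) * (h ^+ 2 * t)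
    + N ^+ 2 * y ^+ 3 * z ^+ 3 * (h ^+ 2 * t ^+ 2))
  + (2 * h - 1) * (N ^+ 2 * y * z)
  + (3 * t - 1) * (N ^+ 3 * h * (y ^+ 2 * z + y * z ^+ 2))); first by ring.
by rewrite N4 h0 t0 !mul0r !addr0.
Qed.

Lemma texp0 : texp 0 = 1.
Proof. by rewrite /texp; ring. Qed.

Lemma texpMn y m : texp (m%:R * y) = texp y ^+ m.
Proof.
elim: m => [|m IH]; first by rewrite mul0r texp0.
by rewrite -natr1 mulrDl mul1r texpD IH exprSr.
Qed.

(** The argument on the right is formally [log(1 - N * y) / N], cut off after the cubic term of the
    logarithm. *)
Lemma texp_log y : 1 - N * y = texp (- y - N * y ^+ 2 * h - N ^+ 2 * y ^+ 3 * t).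
Proof.
have h0 : 2 * h - 1 = 0 by rewrite h2 subrr.
have t0 : 3 * t - 1 = 0 by rewrite t3 subrr.
set w := - y - _ - _.
have w2 : w ^+ 2 = y ^+ 2 + N * (2 * h * y ^+ 3) + N ^+ 2 *
    (y ^+ 4 * (h ^+ 2 + 2 * t) + N * 2 * y ^+ 5 * h * t + N ^+ 2 * y ^+ 6 * t ^+ 2).
  by rewrite /w; ring.
pose v := y ^+ 2 * h + N * y ^+ 3 * t.
have w3 : w ^+ 3 = - y ^+ 3 - N *
    (3 * y ^+ 2 * v + 3 * N * y * v ^+ 2 + N ^+ 2 * v ^+ 3).
  by rewrite /w /v; ring.
(* The remainders [A] and [B] of [w ^+ 2] and [w ^+ 3] occur only multiplied by [N ^+ 4], so their
   shape is irrelevant. *)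
rewrite /texp w2 w3; move: (_ + N ^+ 2 * v ^+ 3) => B.
move: (_ + N ^+ 2 * y ^+ 6 * t ^+ 2) => A; rewrite /w.
apply/eqP; rewrite -subr_eq0; apply/eqP.
transitivity (N ^+ 4 * (B * h * t - A * h)
  + (2 * h - 1) * - ((h + t) * N ^+ 3 * y ^+ 3)
  + (3 * t - 1) * (h * N ^+ 3 * y ^+ 3)); first by ring.
by rewrite N4 h0 t0 !mul0r !addr0.
Qed.

Lemma texp_prod_log (I : Type) (r : seq I) (P : pred I) (x : I -> R) s :
  \prod_(i <- r | P i) (1 - s * N * x i)
  = texp (- (s * \sum_(i <- r | P i) x i)
          - s ^+ 2 * h * (N * \sum_(i <- r | P i) x i ^+ 2)
          - s ^+ 3 * t * (N ^+ 2 * \sum_(i <- r | P i) x i ^+ 3)).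
Proof.
rewrite !mulr_sumr -!sumrN -!big_split /= (big_morph texp texpD texp0).
apply: eq_bigr => i _; rewrite -mulrA mulrCA texp_log; congr texp; ring.
Qed.

(** Write the product with parameter [s] as [texp (l s)]; then [Q = texp (l 1 - l h)]. In
    [u = l k - 2 k (l 1 - l h)] the first power sum cancels since [1 - h = 1/2], and the second
    hypothesis trades [S 2] for [S 3]. The factor 24 clears denominators. *)
Lemma prod_log_congr (I : Type) (r : seq I) (P : pred I) (x : I -> R) (Q : R) k :
  let S i := \sum_(j <- r | P j) x j ^+ i in
  \prod_(i <- r | P i) (1 - N * x i) = Q * \prod_(i <- r | P i) (1 - h * N * x i) ->
  6 * N ^+ 2 * S 2%N = - 7 * N ^+ 3 * S 3%N ->
  24 * \prod_(i <- r | P i) (1 - k%:R * N * x i)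
  = 24 * Q ^+ (2 * k)
    - k%:R * (7 - 14 * k%:R + 8 * k%:R ^+ 2) * N ^+ 3 * S 3%N.
Proof.
move=> S PQ S23.
have h0 : 2 * h - 1 = 0 by rewrite h2 subrr.
have t0 : 3 * t - 1 = 0 by rewrite t3 subrr.
pose S1 := \sum_(i <- r | P i) x i.
pose l s := - (s * S1) - s ^+ 2 * h * (N * S 2%N) - s ^+ 3 * t * (N ^+ 2 * S 3%N).
have PE s : \prod_(i <- r | P i) (1 - s * N * x i) = texp (l s).
  exact: texp_prod_log.
have QE : Q = texp (l 1 - l h).
  have P1 : \prod_(i <- r | P i) (1 - N * x i) = texp (l 1).
    by rewrite -PE; under [RHS]eq_bigr do rewrite mul1r.
  by rewrite texpD -P1 PQ PE -mulrA -texpD subrr texp0 mulr1.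
(* [Q] is 1 modulo [N], so [N ^+ 3] absorbs it and the correction term needs no factor
   [Q ^+ (2 * k)]. *)
have N3Q : N ^+ 3 * Q = N ^+ 3.
  rewrite QE /texp; move: (_ - _) => y.
  transitivity (N ^+ 3 + N ^+ 4 * (y + N * y ^+ 2 * h + N ^+ 2 * y ^+ 3 * (h * t))).
    by ring.
  by rewrite N4 mul0r addr0.
have N3Qk m : N ^+ 3 * Q ^+ m = N ^+ 3.
  by elim: m => [|m IH]; rewrite ?mulr1 // [Q ^+ _]exprS mulrA N3Q.
pose K : R := k%:R.
(* The coefficient of [N ^+ 3 * S 3] in [N * u] once [S 2] is eliminated. *)
pose d := - (7 * h * t) * (2 * K * h * (1 - h ^+ 2) - K ^+ 2 * h)
          + (2 * K * t * (1 - h ^+ 3) - K ^+ 3 * t).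
pose u := l K - (2 * k)%:R * (l 1 - l h).
have N2S2 : N ^+ 2 * S 2%N = - (7 * h * t) * N ^+ 3 * S 3%N.
  transitivity (h * t * (6 * N ^+ 2 * S 2%N)
    - (2 * h - 1) * (3 * t * (N ^+ 2 * S 2%N)) - (3 * t - 1) * (N ^+ 2 * S 2%N)).
    by ring.
  by rewrite h0 t0 !mul0r !subr0 S23; ring.
have Nu : N * u = N ^+ 3 * S 3%N * d.
  transitivity ((N ^+ 2 * S 2%N) * (2 * K * h * (1 - h ^+ 2) - K ^+ 2 * h)
    + N ^+ 3 * S 3%N * (2 * K * t * (1 - h ^+ 3) - K ^+ 3 * t)
    - (2 * h - 1) * (N * K * S1)).
    by rewrite /u /l natrM -/K; ring.
  by rewrite N2S2 h0 mul0r subr0 /d; ring.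
have Eu : texp u = 1 + N ^+ 3 * S 3%N * d.
  rewrite /texp -!exprMn Nu.
  transitivity (1 + N ^+ 3 * S 3%N * d + N ^+ 4 * (N ^+ 2 * (S 3%N * d) ^+ 2 * h
     + N ^+ 5 * (S 3%N * d) ^+ 3 * (h * t))); first by ring.
  by rewrite N4 mul0r addr0.
have -> : \prod_(i <- r | P i) (1 - k%:R * N * x i) = Q ^+ (2 * k) + N ^+ 3 * S 3%N * d.
  rewrite PE -/K -[l K](subrK ((2 * k)%:R * (l 1 - l h))) texpD -/u texpMn -QE Eu.
  rewrite mulrDl mul1r; congr (_ + _).
  by rewrite -[in RHS](N3Qk (2 * k)%N); ring.
have dE : 24 * d = - (7 * K - 14 * K ^+ 2 + 8 * K ^+ 3).
  apply/eqP; rewrite -subr_eq0; apply/eqP.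
  transitivity (- (7 * (2 * h) * (3 * t)) * (8 * K * h * (1 - h ^+ 2) - 4 * K ^+ 2 * h)
     + 8 * (3 * t) * (2 * K * (1 - h ^+ 3) - K ^+ 3) + (7 * K - 14 * K ^+ 2 + 8 * K ^+ 3)).
    by rewrite /d; ring.
  rewrite h2 t3 !mulr1.
  transitivity (- (7 * (4 * K * (2 * h) - K * (2 * h) ^+ 3 - 2 * K ^+ 2 * (2 * h)))
     + 16 * K - 2 * K * (2 * h) ^+ 3 - 8 * K ^+ 3 + (7 * K - 14 * K ^+ 2 + 8 * K ^+ 3)).
    by ring.
  by rewrite h2; ring.
rewrite mulrDr; congr (_ + _).
transitivity (24 * d * (N ^+ 3 * S 3%N)); first by ring.
by rewrite dE -/K; ring.
Qed.

End TruncatedExp.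

(** * Inverse power sums over the units below n / 2 *)

Lemma coprime_subr n j : (j <= n)%N -> coprime n (n - j) = coprime n j.
Proof.
move=> jn; rewrite /coprime -{1 3}(subnK jn) addnC gcdnC gcdnDr.
by rewrite [in RHS]gcdnC gcdnDl gcdnC.
Qed.

Section SplitOdd.
Variables (R : Type) (idx : R) (op : Monoid.com_law idx).

Lemma big_nat_reflect h (F : nat -> R) :
  \big[op/idx]_(1 <= j < h.*2.+1) F j
  = op (\big[op/idx]_(1 <= j < h.+1) F j)
       (\big[op/idx]_(1 <= j < h.+1) F (h.*2.+1 - j)%N).
Proof.
rewrite (@big_cat_nat _ _ _ h.+1) //=; last by lia.
congr (op _ _); rewrite [RHS]big_nat_rev /=.
have -> : h.*2.+1 = (h + h.+1)%N by lia.
rewrite -{1}[h.+1]add0n -[in LHS](addn0 (0 + h.+1)%N).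
have -> : (0 + h.+1 + 0 = 1 + h)%N by lia.
rewrite big_addn; have -> : (h + h.+1 - h = h.+1)%N by lia.
by apply: eq_big_nat => j /andP[j1 jh]; congr F; lia.
Qed.

Lemma big_nat_even_odd h (F : nat -> R) :
  \big[op/idx]_(1 <= j < h.*2.+1) F j
  = op (\big[op/idx]_(1 <= j < h.+1) F j.*2)
       (\big[op/idx]_(1 <= j < h.+1) F (h.*2.+1 - j.*2)%N).
Proof.
(* Reversed, the odd indices become [2 j - 1] in increasing order, which suits induction on [h]. *)
rewrite [X in op _ X]big_nat_rev /=.
have -> : \big[op/idx]_(1 <= j < h.+1) F (h.*2.+1 - (1 + h.+1 - j.+1).*2)%N
  = \big[op/idx]_(1 <= j < h.+1) F (j.*2.-1)%N.
  by apply: eq_big_nat => j /andP[j1 jh]; congr F; lia.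
elim: h => [|h IH]; first by rewrite !big_geq // Monoid.mulm1.
rewrite doubleS big_nat_recr //= big_nat_recr //= IH.
rewrite [X in _ = op X _]big_nat_recr //= [X in _ = op _ X]big_nat_recr //=.
by rewrite Monoid.mulmACA -!Monoid.mulmA doubleS; do 2!congr (op _ _); apply: Monoid.mulmC.
Qed.

Lemma big_coprime_reflect n (F : nat -> R) : odd n ->
  \big[op/idx]_(1 <= j < n | coprime n j) F j
  = op (\big[op/idx]_(1 <= j < n./2.+1 | coprime n j) F j)
       (\big[op/idx]_(1 <= j < n./2.+1 | coprime n j) F (n - j)%N).
Proof.
move=> on; have nE : n = n./2.*2.+1 by lia.
have := big_nat_reflect n./2 (fun j => if coprime n j then F j else idx).
rewrite -nE [in X in _ -> X]big_mkcond => ->; congr (op _ _).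
  by rewrite -big_mkcond.
rewrite [RHS]big_mkcond; apply: eq_big_nat => j /andP[j1 jh].
by rewrite coprime_subr //; lia.
Qed.

Lemma big_coprime_even_odd n (F : nat -> R) : odd n ->
  \big[op/idx]_(1 <= j < n | coprime n j) F j
  = op (\big[op/idx]_(1 <= j < n./2.+1 | coprime n j) F j.*2)
       (\big[op/idx]_(1 <= j < n./2.+1 | coprime n j) F (n - j.*2)%N).
Proof.
move=> on; have nE : n = n./2.*2.+1 by lia.
have c2 j : coprime n j.*2 = coprime n j by rewrite -muln2 coprimeMr coprimen2 on andbT.
have := big_nat_even_odd n./2 (fun j => if coprime n j then F j else idx).
rewrite -nE [in X in _ -> X]big_mkcond => ->; congr (op _ _).
  by rewrite [RHS]big_mkcond; under [LHS]eq_bigr do rewrite c2.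
rewrite [RHS]big_mkcond; apply: eq_big_nat => j /andP[j1 jh].
have -> // : coprime n (n - j.*2) = coprime n j.
by rewrite -(c2 j) coprime_subr //; lia.
Qed.

End SplitOdd.

(** Inclusion-exclusion over [d] dividing [n]: as [d] and [q = n / d] are odd, [(-1)^(d i) = (-1)^i]
    and the inner sum is [d^m (E_m(0) + E_m(q)) / 2]. Replacing [E_m(q)] by [E_m(0)] costs a
    multiple of [d * q = n], up to powers of 2. *)
Lemma sum_alternating_coprime n m : odd n -> (0 < m)%N ->
  (2 ^+ m.+1 * \sum_(1 <= j < n | coprime n j) (-1) ^+ j * j%:R ^+ m
   - 2 * (2 ^+ m * euler0 m) * \prod_(p <- primes n) (1 - p%:R ^+ m)) / n%:R
  \is a Num.int.
Proof.
move=> on m0; have n0 : (0 < n)%N by case: n on.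
rewrite sum_coprime_moebius //.
rewrite -(@sum_moebius _ (fun d : nat => d%:R ^+ m : rat)) ?expr1n //; last first.
  by move=> a b; rewrite natrM exprMn.
rewrite !mulr_sumr -sumrB mulr_suml.
apply: Qint_sum => d; rewrite -dvdn_divisors // => dn.
have d0 : (0 < d)%N := dvdn_gt0 n0 dn.
have nE : n = (d * (n %/ d))%N by rewrite mulnC divnK.
move: nE; set q := (n %/ d)%N => nE.
have [od oq] : odd d /\ odd q by apply/andP; rewrite -oddM -nE.
have -> : \sum_(1 <= i < q) (-1) ^+ (d * i) * (d * i)%:R ^+ m
  = d%:R ^+ m * \sum_(i < q) (-1) ^+ i * i%:R ^+ m :> rat.
  rewrite mulr_sumr; case: q {nE} oq => // q _.
  rewrite big_ord_recl /= -[in 0%N%:R]/(0%N) (_ : 0%:R ^+ m = 0) ?mulr0 ?add0r; last first.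
    by rewrite expr0n; case: m m0.
  rewrite big_add1 /= big_mkord; apply: eq_bigr => i _.
  rewrite /bump /= add1n natrM exprMn exprM -[(-1) ^+ d]signr_odd od expr1; ring.
have := euler_poly_alternating m q.
rewrite euler_poly0 -signr_odd oq expr1 mulN1r opprK => E.
have -> : (2 ^+ m.+1 * ((moebius d)%:~R * (d%:R ^+ m * \sum_(i < q) (-1) ^+ i * i%:R ^+ m)) -
   2 * (2 ^+ m * euler0 m) * ((moebius d)%:~R * d%:R ^+ m)) / n%:R
  = (moebius d)%:~R * (2 ^+ m * d%:R ^+ m * (euler_poly m q%:R - euler0 m) / (d * q)%:R) :> rat.
  rewrite -nE [RHS]mulrA; congr (_ * _^-1).
  transitivity ((moebius d)%:~R * 2 ^+ m * d%:R ^+ m *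
     (2 * (\sum_(i < q) (-1) ^+ i * i%:R ^+ m) - 2 * euler0 m) : rat).
    by rewrite exprS; ring.
  by rewrite E; ring.
by rewrite rpredM ?rpred_int // euler_poly_int // -nE.
Qed.

(** When [N ^+ 4 = 0], multiplying by [N ^+ 3] is the way to use congruences modulo [N] inside
    [R]. *)
Lemma mulr_cube_exprD (R : comPzRingType) (N a : R) m : N ^+ 4 = 0 ->
  N ^+ 3 * (N + a) ^+ m = N ^+ 3 * a ^+ m.
Proof.
move=> N4; elim: m => [|m IH]; first by rewrite !expr0.
rewrite [(N + a) ^+ _]exprS [a ^+ _]exprS mulrCA IH.
transitivity (N ^+ 4 * a ^+ m + N ^+ 3 * (a * a ^+ m)); first by ring.
by rewrite N4 mul0r add0r.
Qed.

(** * The two splittings of the units, in a ring where [n ^ 4 = 0] *)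

Section HalfSystem.
Variables (R : comUnitRingType) (n : nat).
Hypotheses (n_gt1 : (1 < n)%N) (n_odd : odd n) (n_co3 : coprime n 3).
Hypothesis unitR : forall j, coprime n j -> (j%:R : R) \is a GRing.unit.
Let N : R := n%:R.
Hypothesis N4 : N ^+ 4 = 0.
Let h : R := 2^-1.
Let t : R := 3^-1.

Let h2 : 2 * h = 1.
Proof. by rewrite divrr // unitR // coprimen2. Qed.

Let t3 : 3 * t = 1.
Proof. by rewrite divrr // unitR. Qed.

Let r := (\sum_(1 <= j < n./2.+1 | coprime n j) 1)%N.

Lemma totient_half : totient n = r.*2.
Proof.
rewrite totient_count_coprime big_ltn; last exact: ltnW.
rewrite [X in (X + _)%N](_ : _ = 0%N); last by rewrite /coprime gcdn0; case: eqP n_gt1 => // ->.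
rewrite add0n -big_mkcond /= (@big_coprime_reflect _ _ addn n (fun=> 1%N)) //=.
by rewrite addnn.
Qed.

(** Here [n >= 5], so 1 and 2 both count. Hence [totient n >= 4], and [totient n - 3] is not
    truncated. *)
Lemma half_units_gt1 : (1 < r)%N.
Proof.
have n4 : (4 < n)%N.
  by case: (n) n_gt1 n_odd n_co3 => [|[|[|[|[|m]]]]].
rewrite /r big_mkcond big_ltn //; last by lia.
rewrite big_ltn; last by lia.
by rewrite coprimen1 coprimen2 n_odd.
Qed.

Let x j : R := (j%:R)^-1.
Let S i := \sum_(1 <= j < n./2.+1 | coprime n j) x j ^+ i.

Lemma prod_half_double :
  \prod_(1 <= j < n./2.+1 | coprime n j) (1 - N * x j)
  = 2 ^+ totient n * \prod_(1 <= j < n./2.+1 | coprime n j) (1 - h * N * x j).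
Proof.
have := @big_coprime_reflect _ _ *%R n (fun j => j%:R : R) n_odd.
rewrite (big_coprime_even_odd _ _ n_odd) -!big_split /= => E.
(* Multiplied by [- j ^ 2], the factors at [j] become [j (n - j)] on the left and, using a 4 from
   [2 ^ totient n], [2 j (n - 2 j)] on the right. *)
pose A : R := \prod_(1 <= j < n./2.+1 | coprime n j) (- j%:R ^+ 2).
have uA : A \is a GRing.unit.
  by apply: rpred_prod => j cj; rewrite unitrN unitrX // unitR.
apply: (mulrI uA); rewrite mulrCA -!big_split /=.
have -> : 2 ^+ totient n = \prod_(1 <= j < n./2.+1 | coprime n j) 4 :> R.
  rewrite totient_half -mul2n exprM /r -prodrXr; apply: eq_bigr => j _.
  by rewrite expr1 -natrX.
rewrite -big_split /=.
have jh j : (1 <= j < n./2.+1)%N -> (j.*2 < n)%N by lia.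
transitivity (\prod_(1 <= j < n./2.+1 | coprime n j) (j%:R * (n - j)%:R) : R).
  rewrite big_nat_cond [RHS]big_nat_cond; apply: eq_bigr => j /andP[/jh jn cj].
  have xj := divrr (unitR cj); rewrite -/(x j) in xj.
  rewrite natrB -/N; last by lia.
  transitivity (j%:R * (N * (j%:R * x j) - j%:R)); first by ring.
  by rewrite xj mulr1.
rewrite -E big_nat_cond [RHS]big_nat_cond; apply: eq_bigr => j /andP[/jh jn cj].
have xj := divrr (unitR cj); rewrite -/(x j) in xj.
rewrite natrB -/N -?mul2n ?natrM; last by lia.
transitivity (2 * j%:R * ((2 * h) * N * (j%:R * x j) - 2 * j%:R)); last by ring.
by rewrite xj h2 mulr1 mul1r.
Qed.

(** Expand [N^2 / (N - a)^2 = N^2 / a^2 + 2 N^3 / a^3] for [a = j] and [a = 2 j]. With [a], [b] now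
    for [N^2 S_2], [N^3 S_3], four times the equality of the two splittings reads
    [2 a + b = 8 a + 8 b]. *)
Lemma power_sum_half : 6 * N ^+ 2 * S 2%N = - 7 * N ^+ 3 * S 3%N.
Proof.
have sq_inv (a : R) : a \is a GRing.unit -> (N - a) \is a GRing.unit ->
    N ^+ 2 * (N - a)^-1 ^+ 2 = N ^+ 2 * a^-1 ^+ 2 + 2 * N ^+ 3 * a^-1 ^+ 3.
  move=> ua uNa; have ay := divrr ua; have Naz := divrr uNa.
  set y := a^-1 in ay *; set z := (N - a)^-1 in Naz *.
  have E : N ^+ 2 = (N - a) ^+ 2 * (N ^+ 2 * y ^+ 2 + 2 * N ^+ 3 * y ^+ 3).
    transitivity (N ^+ 4 * (2 * N * y ^+ 3 + y ^+ 2 - 4 * (a * y) * y ^+ 2)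
        - 2 * N ^+ 3 * y * (a * y) + N ^+ 2 * (a * y) ^+ 2 + 2 * N ^+ 3 * (a * y) ^+ 2 * y).
      by rewrite N4 ay; ring.
    by ring.
  rewrite {1}E mulrC mulrA -exprMn [z * _]mulrC Naz expr1n mul1r.
  by [].
have jh j : (1 <= j < n./2.+1)%N -> (j.*2 < n)%N by lia.
have := @big_coprime_reflect _ _ +%R n (fun j => N ^+ 2 * x j ^+ 2 : R) n_odd.
rewrite (big_coprime_even_odd _ _ n_odd) /=.
have cB j k : coprime n j -> (k * j < n)%N -> coprime n k -> coprime n (n - k * j).
  by move=> cj kjn ck; rewrite coprime_subr ?coprimeMr ?ck // ltnW.
have termB k : coprime n k -> (k <= 2)%N ->
  \sum_(1 <= j < n./2.+1 | coprime n j) N ^+ 2 * x (n - k * j)%N ^+ 2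
  = (k%:R)^-1 ^+ 2 * (N ^+ 2 * S 2%N) + 2 * (k%:R)^-1 ^+ 3 * (N ^+ 3 * S 3%N).
  move=> ck k2; rewrite /S !mulr_sumr -big_split /=.
  rewrite big_nat_cond [RHS]big_nat_cond; apply: eq_bigr => j /andP[/jh jn cj].
  have kj : (k * j < n)%N by apply: leq_ltn_trans jn; rewrite -mul2n leq_mul2r k2 orbT.
  rewrite /x natrB ?(ltnW kj) // sq_inv ?unitR ?coprimeMr ?ck //; last first.
    by rewrite -natrB ?(ltnW kj) // unitR // cB.
  by rewrite natrM invrM ?unitR // !exprMn; ring.
have -> : \sum_(1 <= j < n./2.+1 | coprime n j) N ^+ 2 * x j.*2 ^+ 2
  = h ^+ 2 * (N ^+ 2 * S 2%N).
  rewrite /S !mulr_sumr; apply: eq_bigr => j cj.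
  by rewrite /x /h -mul2n natrM invrM ?unitR ?coprimen2 // exprMn; ring.
have -> : \sum_(1 <= j < n./2.+1 | coprime n j) N ^+ 2 * x (n - j.*2)%N ^+ 2
  = h ^+ 2 * (N ^+ 2 * S 2%N) + 2 * h ^+ 3 * (N ^+ 3 * S 3%N).
  by rewrite -termB ?coprimen2 //; apply: eq_bigr => j _; rewrite mul2n.
have -> : \sum_(1 <= j < n./2.+1 | coprime n j) N ^+ 2 * x (n - j)%N ^+ 2
  = N ^+ 2 * S 2%N + 2 * (N ^+ 3 * S 3%N).
  transitivity (\sum_(1 <= j < n./2.+1 | coprime n j) N ^+ 2 * x (n - 1 * j)%N ^+ 2).
    by apply: eq_bigr => j _; rewrite mul1n.
  by rewrite termB ?coprimen1 // invr1 !expr1n mulr1 mul1r.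
rewrite -mulr_sumr -/(S 2%N).
move: (N ^+ 2 * S 2%N) (N ^+ 3 * S 3%N) (mulrA 6 (N ^+ 2) (S 2%N))
  (mulrA (-7) (N ^+ 3) (S 3%N)) => a b <- <- E.
have {}E : (2 * h) ^+ 2 * a + ((2 * h) ^+ 2 * a + (2 * h) ^+ 3 * b) = 8 * a + 8 * b.
  transitivity (4 * (h ^+ 2 * a + (h ^+ 2 * a + 2 * h ^+ 3 * b))); first by ring.
  by rewrite E; ring.
rewrite h2 !expr1n !mul1r in E.
apply/eqP; rewrite -subr_eq0; apply/eqP.
transitivity (8 * a + 8 * b - (a + (a + b))); first by ring.
by rewrite E subrr.
Qed.

Lemma cube_mul_totient j : coprime n j -> N ^+ 3 * j%:R ^+ totient n = N ^+ 3.
Proof.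
move=> cj; rewrite coprime_sym in cj; have := Euler_exp_totient cj.
rewrite (modn_small n_gt1) => E.
rewrite -natrX (divn_eq (j ^ totient n) n) E natrD natrM -/N.
transitivity (N ^+ 3 + N ^+ 4 * (j ^ totient n %/ n)%:R); first by ring.
by rewrite N4 mul0r addr0.
Qed.

Let m := (totient n - 3)%N.

Lemma totient_sub3K : totient n = m.+3.
Proof. by rewrite /m; have := half_units_gt1; rewrite totient_half; lia. Qed.

Lemma odd_totient_sub3 : odd m.
Proof. by have := totient_half; rewrite totient_sub3K; lia. Qed.

(** By Euler's theorem [j ^ m] is [j ^ (-3)] modulo [n]. Since [m] is odd, the sign at the odd unit
    [n - 2 j] cancels that of [(- 2 j) ^ m], so it contributes as much as [2 j]. *)
Lemma sum_alternating_cube :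
  N ^+ 3 * \sum_(1 <= j < n | coprime n j) (-1) ^+ j * j%:R ^+ m
  = 2 ^+ m.+1 * (N ^+ 3 * S 3%N).
Proof.
rewrite (big_coprime_even_odd _ _ n_odd) /= -big_split /= /S !mulr_sumr.
rewrite big_nat_cond [RHS]big_nat_cond; apply: eq_bigr => j /andP[jh cj].
have N3x : N ^+ 3 * j%:R ^+ m = N ^+ 3 * x j ^+ 3.
  have xj := divrr (unitR cj); rewrite -/(x j) in xj.
  rewrite -{2}(cube_mul_totient cj) totient_sub3K.
  transitivity (N ^+ 3 * j%:R ^+ m * (j%:R * x j) ^+ 3); first by rewrite xj expr1n mulr1.
  by rewrite !exprS; ring.
rewrite -[(-1) ^+ j.*2]signr_odd odd_double expr0 mul1r.
have -> : (-1) ^+ (n - j.*2) = -1 :> R.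
  by rewrite -signr_odd oddB ?odd_double ?n_odd //; lia.
rewrite natrB; last by lia.
rewrite mulN1r mulrBr -/N mulr_cube_exprD // exprNn -signr_odd odd_totient_sub3 expr1 mulN1r.
by rewrite -mul2n natrM exprMn -N3x [2 ^+ m.+1]exprS; ring.
Qed.

Let w : R := 2 ^+ m.+1.

(** Modulo [n], [4 * w = 2 ^ totient n] is 1, so [w] acts as 1/4 and [w * (1 - w)] as 3/16. The
    hypothesis becomes [w^2 T = 2 B] with [T = N^3 S_3] and [B = N^3 b], whence [T = 32 B]. *)
Lemma cube_sum_congr (b z : int) :
  2 ^+ m.+1 * (\sum_(1 <= j < n | coprime n j) (-1) ^+ j * j%:R ^+ m) - 2 * b
    = n%:R * z ->
  N ^+ 3 * S 3%N * (w * (1 - w)) = 6 * (N ^+ 3 * b%:~R).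
Proof.
move/(congr1 (fun y : int => y%:~R : R)).
rewrite rmorphB !rmorphM rmorphXn rmorph_sum !rmorph_nat -/N -/w.
have -> : \sum_(1 <= j < n | coprime n j) (((-1) ^+ j * j%:R ^+ m : int)%:~R : R)
   = \sum_(1 <= j < n | coprime n j) (-1) ^+ j * j%:R ^+ m.
  by apply: eq_bigr => j _; rewrite rmorphM !rmorphXn rmorphN1 rmorph_nat.
move/(congr1 (fun y => N ^+ 3 * y)); rewrite /= mulrBr.
have -> : N ^+ 3 * (N * z%:~R) = 0 by rewrite mulrA -exprSr N4 mul0r.
rewrite (mulrCA _ w) sum_alternating_cube -/w.
have w4 : N ^+ 3 * (4 * w) = N ^+ 3.
  rewrite -[RHS](cube_mul_totient (j := 2)) ?coprimen2 // totient_sub3K /w !exprS.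
  by ring.
have : 4 * w * (N ^+ 3 * S 3%N) = N ^+ 3 * S 3%N by rewrite mulrA [4 * w * _]mulrC w4.
rewrite (mulrCA _ 2); move: (N ^+ 3 * S 3%N) (N ^+ 3 * b%:~R) => T B wT wB.
have TB : T = 32 * B.
  transitivity (4 * w * (4 * w * T)); first by rewrite !wT.
  transitivity (16 * (w * (w * T) - 2 * B) + 32 * B); first by ring.
  by rewrite wB mulr0 add0r.
transitivity ((2 * h) ^+ 4 * (T * (w * (1 - w)))); first by rewrite h2 expr1n mul1r.
transitivity (h ^+ 4 * (4 * (4 * w * T) - 4 * w * (4 * w * T))); first by ring.
rewrite !wT TB; transitivity ((2 * h) ^+ 4 * (6 * B)); first by ring.
by rewrite h2 expr1n mul1r.
Qed.

(** The theorem with denominators cleared: [w * (1 - w)] turns the Bernoulli quotient into the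
    integer [b], and the product of the [j] clears the left-hand side. *)
Lemma prod_half_congr k (b z : int) :
  2 ^+ m.+1 * (\sum_(1 <= j < n | coprime n j) (-1) ^+ j * j%:R ^+ m) - 2 * b
    = n%:R * z ->
  4 * (w * (1 - w)) * \prod_(1 <= j < n./2.+1 | coprime n j) (k%:R * N - j%:R)
  = (-1) ^+ (totient n %/ 2) * (\prod_(1 <= j < n./2.+1 | coprime n j) j%:R)
    * (4 * (w * (1 - w)) * 4 ^+ (k * totient n)
       - k%:R * (7 - 14 * k%:R + 8 * k%:R ^+ 2) * N ^+ 3 * b%:~R).
Proof.
move=> /cube_sum_congr S3b.
have := prod_log_congr N4 h2 t3 k prod_half_double power_sum_half.
rewrite -/(S 3%N) -exprM mulnC -mulnA exprM.
have -> : (2 ^+ 2 : R) = 4 by rewrite -natrX.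
set P := \prod_(_ <= j < _ | _) (1 - k%:R * N * x j) => PE.
have -> : \prod_(1 <= j < n./2.+1 | coprime n j) (k%:R * N - j%:R)
  = (-1) ^+ (totient n %/ 2) * (\prod_(1 <= j < n./2.+1 | coprime n j) j%:R) * P.
  have -> : (totient n %/ 2 = r)%N by rewrite totient_half; lia.
  rewrite /r -prodrXr -!big_split /=; apply: eq_bigr => j cj.
  have xj := divrr (unitR cj); rewrite -/(x j) in xj.
  transitivity (k%:R * N * (j%:R * x j) - j%:R); first by rewrite xj mulr1.
  by ring.
rewrite mulrCA; congr (_ * _).
(* Since 6 is invertible, both sides may be multiplied by it to reach the [24 * P] of [PE]. *)
have u6 (y : R) : y = h * t * (6 * y).
  transitivity ((2 * h) * (3 * t) * y); last by ring.
  by rewrite h2 t3 !mul1r.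
rewrite [LHS]u6 [RHS]u6; congr (_ * _).
transitivity ((w * (1 - w)) * (24 * P)); first by ring.
rewrite PE.
transitivity (24 * (w * (1 - w)) * 4 ^+ (k * totient n)
  - k%:R * (7 - 14 * k%:R + 8 * k%:R ^+ 2) * (N ^+ 3 * S 3%N * (w * (1 - w)))).
  by ring.
by rewrite S3b; ring.
Qed.

End HalfSystem.

(** * From ['Z_(n ^ 4)] back to congruences between rationals *)

Lemma intr_Zp_eq0 (M : nat) (y : int) : (1 < M)%N ->
  (y%:~R == 0 :> 'Z_M) = (M%:Z %| y)%Z.
Proof.
move=> M1; rewrite dvdzE.
have natE (a : nat) : (a%:R == 0 :> 'Z_M) = (M %| a)%N.
  by rewrite -val_eqE /= val_Zp_nat.
by case: (intP y) => [|a|a]; rewrite ?rmorphN ?oppr_eq0 ?abszN /= -?pmulrn natE.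
Qed.

(** [D] is a common denominator prime to [M]: the denominator of [(a - b) / M] divides it. *)
Lemma eqmodqI (a b : rat) (M : nat) (D W : int) : (1 < M)%N -> coprimez D M%:Z ->
  (a - b) * D%:~R = (M%:Z * W)%:~R -> eqmodq a b M.
Proof.
move=> M1 cDM E; rewrite /eqmodq; set q := _ / _.
have M0 : M%:R != 0 :> rat by rewrite pnatr_eq0; case: M M1 {cDM E q}.
have qE : q * D%:~R = W%:~R.
  apply: (mulfI M0); rewrite mulrA [M%:R * q]mulrC divfK // E rmorphM /=.
  by rewrite -pmulrn.
have dD : (denq q %| D)%Z.
  have : (denq q %| numq q * D)%Z.
    apply/dvdzP; exists W; apply/eqP; rewrite -(eqr_int rat) !rmorphM /= -qE.
    by rewrite -{2}(divq_num_den q) mulrAC divfK ?intr_eq0 ?denq_neq0.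
  by rewrite Gauss_dvdzr // coprimez_sym; apply: coprime_num_den.
by rewrite !coprimezE in cDM *; apply: coprime_dvdl cDM.
Qed.

(** With [w = 2 ^+ (totient n - 2)], Euler gives [4 w = 1] modulo [n], so
    [16 w (1 - w) = 4 w (4 - 4 w)] is 3 modulo [n]. *)
Lemma coprimez_pow2_totient n : odd n -> coprime n 3 -> (1 < n)%N -> (2 <= totient n)%N ->
  coprimez (2 ^+ (totient n - 2) * (1 - 2 ^+ (totient n - 2))) n%:Z.
Proof.
move=> on c3 n1 phi2; set w := 2 ^+ _.
have w4 : (4 * w = 2 ^+ totient n :> int).
  by rewrite /w -[in RHS](subnK phi2) exprD mulrC.
have c2 : coprime 2 n by rewrite coprime2n.
have := Euler_exp_totient c2; rewrite (modn_small n1) => E.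
have qE : 4 * w = (2 ^ totient n %/ n)%N%:Z * n%:Z + 1.
  by rewrite w4 -natrX natz {1}(divn_eq (2 ^ totient n) n) E PoszD PoszM.
move: qE; set q := (_ %/ _)%N%:Z => qE.
have cE : 16 * (w * (1 - w)) = (q * (2 - q * n%:Z)) * n%:Z + 3.
  transitivity (4 * w * (4 - 4 * w)); first by ring.
  by rewrite qE; ring.
have : coprimez n%:Z (16 * (w * (1 - w))) by rewrite cE /coprimez gcdzMDl.
by rewrite coprimezMr => /andP[_]; rewrite coprimez_sym.
Qed.

Theorem theorem3p3 (n k : nat) (n_gt1 : (1 < n)%N) (n_co6 : gcdn n 6 = 1%N)
    (k_gt0 : (0 < k)%N) :
  eqmodq
    (\prod_(d <- divisors n)
       ('C(k * d - 1, (d - 1) %/ 2)%:R : rat) ^ moebius (n %/ d))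
    ((-1) ^+ (totient n %/ 2) *
       (4%:R ^+ (k * totient n)
        - k%:R * (7%:R - 14%:R * k%:R + 8%:R * k%:R ^+ 2) / 4%:R
          * n%:R ^+ 3
          * (bernoulli_triv (totient n - 2) n / (totient n - 2)%:R)))
    (n ^ 4).
Proof.
have [n_odd n_co3] : odd n /\ coprime n 3.
  by apply/andP; rewrite -coprimen2 -(@coprimeMr n 2 3); apply/eqP.
have n4_gt1 : (1 < n ^ 4)%N by rewrite -(exp1n 4) ltn_exp2r.
have unitR j : coprime n j -> (j%:R : 'Z_(n ^ 4)) \is a GRing.unit.
  by move=> cj; rewrite unitZpE // coprimeXl.
have N4 : (n%:R : 'Z_(n ^ 4)) ^+ 4 = 0 by rewrite -natrX pchar_Zp.
have mE := totient_sub3K n_gt1 n_odd n_co3.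
set m := (totient n - 3)%N in mE.
have m_gt0 : (0 < m)%N := odd_gt0 (odd_totient_sub3 n_gt1 n_odd n_co3).
have sE : (totient n - 2 = m.+1)%N by lia.
have /intrP[e eE] := euler0_int m.
have /intrP[z zE] := sum_alternating_coprime n_odd m_gt0.
have n0 : n%:R != 0 :> rat by rewrite pnatr_eq0; lia.
have [b bE] : exists b : int,
    b%:~R = 2 ^+ m * euler0 m * \prod_(p <- primes n) (1 - p%:R ^+ m) :> rat.
  exists (e * \prod_(p <- primes n) (1 - p%:R ^+ m)).
  rewrite rmorphM /= -eE rmorph_prod; congr (_ * _); apply: eq_bigr => p _.
  by rewrite rmorphB rmorphXn /= rmorph_nat.
have bz : 2 ^+ m.+1 * (\sum_(1 <= j < n | coprime n j) (-1) ^+ j * j%:R ^+ m) - 2 * b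
    = n%:R * z.
  apply/eqP; rewrite -(eqr_int rat) rmorphB !rmorphM /= bE -zE rmorphXn rmorph_sum.
  rewrite !rmorph_nat [n%:R * _]mulrC divfK // !mulrA; apply/eqP; congr (_ * _ - _).
  by apply: eq_bigr => j _; rewrite rmorphM !rmorphXn rmorphN1 rmorph_nat.
(* The common denominator will be [4 * c * A]: 4 from the statement, [c] from the Bernoulli
   quotient, [A] from the fractions [(k n - j) / j]. *)
pose c : int := 2 ^+ m.+1 * (1 - 2 ^+ m.+1).
pose A : int := \prod_(1 <= j < n./2.+1 | coprime n j) j%:R.
pose X : int := \prod_(1 <= j < n./2.+1 | coprime n j) (k%:R * n%:R - j%:R).
pose K : int := k%:R * (7 - 14 * k%:R + 8 * k%:R ^+ 2).
have coD : coprimez (4 * c * A) (n ^ 4)%N%:Z.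
  rewrite coprimezE abszM abszM coprimeXr // !coprimeMl.
  have co4 : coprime (2 ^ 2) n by rewrite coprimeXl // coprime2n.
  rewrite -[`|4|%N]/(2 ^ 2)%N co4.
  have := @coprimez_pow2_totient n n_odd n_co3 n_gt1; rewrite sE -/c coprimezE => -> /=; last by lia.
  rewrite /A; elim/big_rec: _ => [|j y cj cy]; first by rewrite coprime1n.
  by rewrite abszM coprimeMl cy andbT natz coprime_sym.
have cE (T : comPzRingType) : c%:~R = 2 ^+ m.+1 * (1 - 2 ^+ m.+1) :> T.
  by rewrite rmorphM rmorphB !rmorphXn.
have AE (T : comPzRingType) :
    A%:~R = \prod_(1 <= j < n./2.+1 | coprime n j) j%:R :> T.
  by rewrite rmorph_prod; apply: eq_bigr => j _; rewrite rmorph_nat.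
have XE (T : comPzRingType) :
    X%:~R = \prod_(1 <= j < n./2.+1 | coprime n j) (k%:R * n%:R - j%:R) :> T.
  rewrite rmorph_prod; apply: eq_bigr => j _.
  by rewrite rmorphB rmorphM /= !rmorph_nat.
have KE (T : comPzRingType) : K%:~R = k%:R * (7 - 14 * k%:R + 8 * k%:R ^+ 2) :> T.
  by rewrite rmorphM rmorphD rmorphB !rmorphM !rmorph_nat.
clearbody c A X K.
(* In the rationals [Y] is the difference of the two sides times [4 * c * A]; in ['Z_(n ^ 4)] it
   vanishes by [prod_half_congr]. *)
pose Y : int := 4 * c * X - (-1) ^+ (totient n %/ 2) * A *
  (4 * c * 4 ^+ (k * totient n) - K * n%:R ^+ 3 * b).
have YE (T : comPzRingType) : Y%:~R = 4 * c%:~R * X%:~R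
    - (-1) ^+ (totient n %/ 2) * A%:~R *
      (4 * c%:~R * 4 ^+ (k * totient n) - K%:~R * n%:R ^+ 3 * b%:~R) :> T.
  by rewrite /Y !(rmorphB, rmorphM) /= !rmorphXn rmorphN1 /= !rmorph_nat.
have /dvdzP[W WE] : ((n ^ 4)%N%:Z %| Y)%Z.
  rewrite -intr_Zp_eq0 // YE subr_eq0 cE AE XE KE.
  by have := prod_half_congr n_gt1 n_odd n_co3 unitR N4 k bz; rewrite -/m => ->.
apply: (@eqmodqI _ _ _ (4 * c * A) W) => //.
rewrite [in RHS]mulrC -WE YE prod_bin_moebius // sE.
have -> : bernoulli_triv m.+1 n / m.+1%:R
   = bernoulli m.+1 / m.+1%:R * \prod_(p <- primes n) (1 - p%:R ^+ m).
  rewrite /bernoulli_triv mulrAC; congr (_ * _); apply: eq_bigr => p _.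
  by rewrite -addn1 PoszD addrK.
have aX : \prod_(1 <= j < n./2.+1 | coprime n j) ((k%:R * n%:R - j%:R) / j%:R) * A%:~R
   = X%:~R :> rat.
  rewrite AE XE -big_split /= big_nat_cond [RHS]big_nat_cond.
  apply: eq_bigr => j /andP[/andP[j0 _] _].
  by rewrite divfK // pnatr_eq0 -lt0n.
have cb : c%:~R * (bernoulli m.+1 / m.+1%:R * \prod_(p <- primes n) (1 - p%:R ^+ m))
   = b%:~R :> rat.
  rewrite bE cE /euler0 [2 ^+ m.+1]exprS.
  by move: (m.+1%:R^-1) (bernoulli _) (\prod_(_ <- _) _) => *; ring.
move: cb; set be := bernoulli _ / _ * _ => cb.
rewrite -aX -cb KE !rmorphM /= rmorph_nat.
move: (\prod_(_ <= _ < _ | _) _) (A%:~R) (c%:~R) be {cb aX} => a A' c' be.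
by field.
Qed.
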